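(* Let $S$, $\mathcal Z$, $h^{\mathcal Z}$, $R$ be as in the context. The response metric $g_R=R^*h^{\mathcal Z}$ is a smooth symmetric positive-semidefinite covariant $2$-tensor on $S$. Moreover, $\ker (g_R)_p=\ker R_p$ for every $p\in S$, where $\ker(g_R)_p=\{X\in T_pS:(g_R)_p(X,Y)=0\ \text{for all }Y\in T_pS\}$.
   Context: $S$ is a smooth finite-dimensional manifold parameterizing a smooth family $\{g_p\}_{p\in S}$ of normalized Einstein metrics on a fixed smooth manifold $M$. The family comes with the following given data, which is all that the statement uses: a smooth real vector bundle $\pi_{\mathcal Z}:\mathcal Z\to S$ of finite rank (the observation bundle), a smooth positive-definite fibre metric $h^{\mathcal Z}$ on $\mathcal Z$, and a smooth vector bundle morphism $R:TS\to\mathcal Z$ over the identity of $S$ (the response bundle morphism), with fibre maps $R_p:T_pS\to\mathcal Z_p$. The response metric is defined by $(g_R)_p(X,Y)=h^{\mathcal Z}_p(R_pX,R_pY)$ for $X,Y\in T_pS$. *)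

(* Defs.v *)
From HB Require Import structures.
From mathcomp Require Import all_boot all_order all_algebra.
From mathcomp Require Import boolp classical_sets functions reals.
From mathcomp Require Import topology normedtype landau derive.

Set Implicit Arguments.
Unset Strict Implicit.
Unset Printing Implicit Defensive.
Import Order.TTheory GRing.Theory Num.Theory.
Import numFieldNormedType.Exports.
Local Open Scope classical_set_scope.
Local Open Scope ring_scope.

(* [Ck k A f]: [f] is of class C^k on the open set [A].  For [V] of finite
   dimension, x |-> 'd f x is C^k iff x |-> 'd f x v is C^k for every [v]. *)
Fixpoint Ck (R : realType) (V W : normedModType R) (k : nat) (A : set V)
    (f : V -> W) : Prop :=
  if k is k'.+1 then
    (forall x, A x -> differentiable f x) /\
    (forall v, Ck k' A (fun x => 'd f x v))
  else forall x, A x -> {for x, continuous f}.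

Definition smooth_on (R : realType) (V W : normedModType R) (A : set V)
  (f : V -> W) : Prop := forall k, Ck k A f.

Section CkTheory.
Context {R : realType}.

Lemma near_eq_diff (V W : normedModType R) (f g : V -> W) (x : V) :
  (\forall y \near x, f y = g y) -> differentiable f x ->
  differentiable g x /\ ('d g x : V -> W) = 'd f x.
Proof.
move=> fg df; have fgx : f x = g x := nbhs_singleton fg.
have gE : g \o shift x = cst (g x) + 'd f x +o_ 0 id.
  apply/eqaddoP => e e0; rewrite -fgx.
  have /diff_locally/eqaddoP/(_ e e0) := df.
  have : \forall h \near 0, f (h + x) = g (h + x).
    by move: fg; rewrite (near_shift 0 x) /= subr0; apply: filterS => h /=.
  by apply: filterS2 => h /= E; rewrite !fctE /= E.
have dgE : ('d g x : V -> W) = 'd f x.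
  exact: diff_unique (diff_continuous df) gE.
by split=> //; apply/diff_locallyP; rewrite dgE; split=> //; exact: diff_continuous.
Qed.

Lemma near_diff_comp (U V W : normedModType R) (f : U -> V) (g : V -> W)
    (h : U -> W) (x : U) (y : V) (u : U) :
  f x = y -> (\forall z \near x, g (f z) = h z) ->
  differentiable f x -> differentiable g y -> 'd g y ('d f x u) = 'd h x u.
Proof.
move=> <- gfh df dg.
have [_ ->] := near_eq_diff gfh (differentiable_comp df dg).
by rewrite (diff_comp df dg).
Qed.

Lemma Ck_ext (V W : normedModType R) k (A : set V) (f g : V -> W) :
  open A -> (forall x, A x -> f x = g x) -> Ck k A f -> Ck k A g.
Proof.
move=> oA; elim: k f g => [|k IH] f g fg /=.
  move=> cf x Ax; rewrite /prop_for /continuous_at -fg //.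
  apply: cvg_trans (cf x Ax); apply: near_eq_cvg.
  by apply: filterS (open_nbhs_nbhs (conj oA Ax)) => y /fg.
have N x : A x -> \forall y \near x, f y = g y.
  by move=> Ax; apply: filterS (open_nbhs_nbhs (conj oA Ax)) => y /fg.
move=> [df cf]; split=> [x Ax|v].
  by have [] := near_eq_diff (N x Ax) (df x Ax).
apply: IH (cf v) => x Ax.
by have [_ ->] := near_eq_diff (N x Ax) (df x Ax).
Qed.

Lemma CkW (V W : normedModType R) k (A : set V) (f : V -> W) :
  Ck k.+1 A f -> Ck k A f.
Proof.
elim: k f => [|k IH] f [df cf] /=.
  by move=> x Ax; apply: differentiable_continuous; exact: df.
by split=> // v; apply: IH.
Qed.

Lemma CkD (V W : normedModType R) k (A : set V) (f g : V -> W) :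
  open A -> Ck k A f -> Ck k A g -> Ck k A (f \+ g).
Proof.
move=> oA; elim: k f g => [|k IH] f g /=.
  by move=> cf cg x Ax; apply: continuousD; [exact: cf|exact: cg].
move=> [df cf] [dg cg]; split=> [x Ax|v].
  by apply: differentiableD; [exact: df|exact: dg].
apply: Ck_ext (IH _ _ (cf v) (cg v)) => // x Ax.
by rewrite diffD; [|exact: df|exact: dg].
Qed.

Lemma Ck_cst (V W : normedModType R) k (A : set V) (w : W) :
  Ck k A (fun _ => w).
Proof.
elim: k w => [|k IH] w /=; first by move=> x _; exact: cvg_cst.
split=> [x _|v]; first exact: differentiable_cst.
rewrite (_ : (fun x => _) = fun _ => 0); first exact: IH.
by apply/funext => x; rewrite diff_cst.
Qed.

Lemma Ck_sum (V W : normedModType R) k (A : set V) n (f : 'I_n -> V -> W) :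
  open A -> (forall i, Ck k A (f i)) -> Ck k A (fun x => \sum_(i < n) f i x).
Proof.
move=> oA; elim: n f => [|n IH] f cf.
  under eq_fun do rewrite big_ord0; exact: Ck_cst.
under eq_fun do rewrite big_ord_recr /=.
by apply: CkD => //; apply: IH.
Qed.

Definition scal (W : normedModType R) (a : R) (w : W) : W := a *: w.

Lemma scale_is_bilinear (W : normedModType R) :
  bilinear_for
    (GRing.Scale.Law.clone _ _ *:%R _) (GRing.Scale.Law.clone _ _ *:%R _)
    (@scal W).
Proof.
rewrite /scal; split=> [u'|u] a x y /=.
- by rewrite scalerDl scalerA.
- by rewrite scalerDr !scalerA [u * a]mulrC.
Qed.
HB.instance Definition _ (W : normedModType R) :=
  bilinear_isBilinear.Build R R W W _ _ (@scal W)
    (scale_is_bilinear W).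

Lemma diff_scale (V W : normedModType R) (a : V -> R) (f : V -> W) (x : V) :
  differentiable a x -> differentiable f x ->
  differentiable (fun y => a y *: f y) x /\
  forall v, 'd (fun y => a y *: f y) x v = a x *: 'd f x v + 'd a x v *: f x.
Proof.
move=> da df; pose B (p : R * W) := p.1 *: p.2.
have Bc : continuous B by move=> p; exact: scale_continuous.
have dp := differentiable_pair da df.
have dB := differentiable_bilin (f := @scal W) (a x, f x) Bc.
have E : (fun y => a y *: f y) = B \o (fun y => (a y, f y)) by [].
split; first by rewrite E; exact: differentiable_comp.
move=> v; rewrite E diff_comp //= diff_pair //.
by rewrite (diff_bilin (f := @scal W) (a x, f x) Bc).
Qed.

Lemma Ck_sub (V W : normedModType R) k (A B : set V) (f : V -> W) :
  A `<=` B -> Ck k B f -> Ck k A f.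
Proof.
move=> AB; elim: k f => [|k IH] f /=; first by move=> cf x /AB; exact: cf.
by move=> [df cf]; split=> [x /AB|v]; [exact: df|exact: IH].
Qed.

Lemma Ck_scale (V W : normedModType R) k (A : set V) (a : V -> R)
    (f : V -> W) :
  open A -> Ck k A a -> Ck k A f -> Ck k A (fun x => a x *: f x).
Proof.
move=> oA; elim: k a f => [|k IH] a f.
  by move=> /= ca cf x Ax; apply: continuousZ; [exact: ca|exact: cf].
move=> ca cf; have [da ca'] := ca; have [df cf'] := cf.
split=> [x Ax|v]; first by have [] := diff_scale (da x Ax) (df x Ax).
apply: (@Ck_ext _ _ _ _
  ((fun x => a x *: 'd f x v) \+ (fun x => 'd a x v *: f x))) => //.
  move=> x Ax /=; have [_ /(_ v) ->] := diff_scale (da x Ax) (df x Ax).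
  by [].
apply: CkD => //.
  by apply: IH; [exact: CkW ca|exact: cf' v].
by apply: IH; [exact: ca' v|exact: CkW cf].
Qed.

Lemma Ck_lin (V W W' : normedModType R) k (A : set V) (f : V -> W)
    (l : {linear W -> W'}) :
  open A -> continuous l -> Ck k A f -> Ck k A (l \o f).
Proof.
move=> oA lc; elim: k f => [|k IH] f /=.
  by move=> cf x Ax; apply: continuous_comp; [exact: cf|exact: lc].
move=> [df cf]; split=> [x Ax|v].
  by apply: differentiable_comp; [exact: df|exact: linear_differentiable].
apply: Ck_ext (IH _ (cf v)) => // x Ax.
rewrite diff_comp; [|exact: df|exact: linear_differentiable].
by rewrite /= diff_lin.
Qed.

Lemma Ck_comp (V W : normedModType R) m k (A : set V) (B : set 'rV[R]_m)
    (f : V -> 'rV[R]_m) (g : 'rV[R]_m -> W) :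
  open A -> f @` A `<=` B -> Ck k A f -> Ck k B g -> Ck k A (g \o f).
Proof.
move=> oA fAB; have fB x : A x -> B (f x) by move=> Ax; apply: fAB; exists x.
elim: k g => [|k IH] g.
  move=> cf cg x Ax; apply: continuous_comp; first exact: cf.
  exact: cg (fB _ Ax).
move=> cf [dg cg]; have [df cf'] := cf; split=> [x Ax|v].
  exact: differentiable_comp (df x Ax) (dg _ (fB _ Ax)).
apply: (@Ck_ext _ _ _ _ (fun x => \sum_(j < m)
    ('d f x v) 0 j *: ((fun y => 'd g y (delta_mx 0 j)) \o f) x)) => //.
  move=> x Ax; rewrite (diff_comp (df x Ax) (dg _ (fB _ Ax))).
  rewrite /= [in RHS](row_sum_delta ('d f x v)) linear_sum.
  by apply: eq_bigr => j _; rewrite linearZ.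
apply: Ck_sum => // j; apply: Ck_scale => //.
  have @l : {linear 'rV[R]_m -> R}.
    by exists (fun u : 'rV[R]_m => u 0 j); do 2![eexists]; do ?[constructor];
       rewrite ?mxE// => ? *; rewrite ?mxE//; move=> ?; rewrite !mxE.
  by apply: (@Ck_lin _ _ _ _ _ _ l); [|exact: coord_continuous|exact: cf'].
by apply: IH; [exact: CkW cf|exact: cg].
Qed.

End CkTheory.

Section Manifolds.
Context {R : realType}.

Record chart (S : topologicalType) (n : nat) := Chart {
  cdom : set S;
  coord : S -> 'rV[R]_n;
  param : 'rV[R]_n -> S;
  cdom_open : open cdom;
  cimg_open : open (coord @` cdom);
  coordK : forall p, cdom p -> param (coord p) = p;
  coord_cts : forall p, cdom p -> {for p, continuous coord};
  param_cts : forall x, (coord @` cdom) x -> {for x, continuous param}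
}.

Record manifold (n : nat) := Manifold {
  space :> topologicalType;
  atlas : set (chart space n);
  space_hausdorff : hausdorff_space space;
  space_second_countable : @second_countable space;
  atlas_cover : forall p, exists2 phi, atlas phi & cdom phi p;
  atlas_smooth : forall phi psi, atlas phi -> atlas psi ->
    smooth_on (coord phi @` (cdom phi `&` cdom psi)) (coord psi \o param phi)
}.

(* [U] is an open subset of [S] *)
Definition smooth_map_on n (S : manifold n) (W : normedModType R) (U : set S)
    (f : S -> W) : Prop :=
  forall phi, atlas phi ->
    smooth_on (coord phi @` (U `&` cdom phi)) (f \o param phi).

(* [triv p] and [trivV p] are junk when p is outside of [tdom]. *)
Record trivialization n (S : manifold n) (r : nat) (E : S -> lmodType R) :=
  Trivialization {
  tdom : set S;
  triv : forall p, E p -> 'rV[R]_r;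
  trivV : forall p, 'rV[R]_r -> E p;
  tdom_open : open tdom;
  triv_linear : forall p, tdom p -> linear (triv (p := p));
  trivK : forall p, tdom p -> cancel (triv (p := p)) (trivV p);
  trivVK : forall p, tdom p -> cancel (trivV p) (triv (p := p))
}.

(* A smooth vector bundle of rank [r], given by its fibres and an atlas of
   local trivializations whose transition functions are smooth; its total
   space is {p : S & fibre p}, see [tot_coord] for the charts. *)
Record vbundle n (S : manifold n) (r : nat) := VBundle {
  fibre :> S -> lmodType R;
  trivs : set (trivialization r fibre);
  trivs_cover : forall p, exists2 t, trivs t & tdom t p;
  trivs_smooth : forall s t, trivs s -> trivs t -> forall u : 'rV[R]_r,
    smooth_map_on (tdom s `&` tdom t) (fun p => triv t (trivV s p u))
}.

Section TotalSpace.
Variables (n : nat) (S : manifold n) (r : nat) (E : vbundle S r).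
Implicit Types (phi : chart S n) (t : trivialization r E).

Definition tot_dom phi t : set {p : S & E p} :=
  [set e | cdom phi (tag e) /\ tdom t (tag e)].

Definition tot_coord phi t (e : {p : S & E p}) : 'rV[R]_(n + r) :=
  row_mx (coord phi (tag e)) (triv t (tagged e)).

Definition tot_param phi t (z : 'rV[R]_(n + r)) : {p : S & E p} :=
  existT (fun p : S => E p) (param phi (lsubmx z)) (trivV t _ (rsubmx z)).

End TotalSpace.

(* Smoothness of the map of total spaces induced by [F], in the charts of the
   total spaces; its continuity is automatic as it covers the identity. *)
Definition smooth_bundle_map n (S : manifold n) r r' (E : vbundle S r)
    (E' : vbundle S r') (F : forall p, E p -> E' p) : Prop :=
  let totF (e : {p : S & E p}) := 
    existT (fun p : S => E' p) (tag e) (F (tag e) (tagged e)) in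
  forall phi t phi' t', atlas phi -> trivs t -> atlas phi' -> trivs t' ->
    smooth_on
      (tot_coord phi t @` (tot_dom phi t `&` totF @^-1` tot_dom phi' t'))
      (tot_coord phi' t' \o totF \o tot_param phi t).

Record bundle_morphism n (S : manifold n) r r' (E : vbundle S r)
    (E' : vbundle S r') := BundleMorphism {
  bmap :> forall p, {linear E p -> E' p};
  bmap_smooth : smooth_bundle_map bmap
}.

(* The section [b] of the bundle of bilinear forms on [E] has smooth
   components in the frames given by the trivializations of [E]. *)
Definition smooth_form n (S : manifold n) r (E : vbundle S r)
    (b : forall p, E p -> E p -> R) : Prop :=
  forall t, trivs t -> forall u v : 'rV[R]_r,
    smooth_map_on (tdom t) (fun p => b p (trivV t p u) (trivV t p v)).

Definition bilinear_form (V : lmodType R) (b : V -> V -> R) : Prop :=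
  (forall x, scalar (b x)) /\ (forall y, scalar (b^~ y)).

Record fibre_metric n (S : manifold n) r (E : vbundle S r) := FibreMetric {
  fmet :> forall p, E p -> E p -> R;
  fmet_bilinear : forall p, bilinear_form (@fmet p);
  fmet_sym : forall p x y, @fmet p x y = @fmet p y x;
  fmet_posdef : forall p x, x != 0 -> 0 < @fmet p x x;
  fmet_smooth : smooth_form fmet
}.

Section Tangent.
Variables (n : nat) (S : manifold n).

Definition chart_at (p : S) : Type :=
  {phi : chart S n | atlas phi /\ cdom phi p}.

(* A tangent vector at [p] is the family of its coordinates in all the charts
   at [p], which are related by the differentials of the transition maps. *)
Definition tangent_pred (p : S) : {pred chart_at p -> 'rV[R]_n} :=
  fun v => `[< forall phi psi : chart_at p,
    v psi = 'd (coord (sval psi) \o param (sval phi)) (coord (sval phi) p)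
              (v phi) >].
Arguments tangent_pred : clear implicits.

Lemma tangent_submod_closed p : submod_closed (tangent_pred p).
Proof.
split=> [|a v w /asboolP hv /asboolP hw].
  by apply/asboolP => phi psi; rewrite linear0.
by apply/asboolP => phi psi; rewrite linearP -hv -hw.
Qed.

HB.instance Definition _ p :=
  GRing.isSubmodClosed.Build _ _ (tangent_pred p) (tangent_submod_closed p).

Record tangent (p : S) := Tangent {
  tangent_coord :> chart_at p -> 'rV[R]_n;
  tangentP : tangent_coord \in tangent_pred p
}.

HB.instance Definition _ p := [isSub for @tangent_coord p].
HB.instance Definition _ p := [Choice of tangent p by <:].
HB.instance Definition _ p := [SubChoice_isSubLmodule of tangent p by <:].

Lemma coord_open (phi : chart S n) (A : set S) :
  open A -> A `<=` cdom phi -> open (coord phi @` A).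
Proof.
move=> oA sA; have -> : coord phi @` A =
    (coord phi @` cdom phi) `&` (param phi @^-1` A).
  apply/seteqP; split=> [_ [p Ap <-]|_ [[p dp <-]]] /=.
    by split; [exists p => //; exact: sA|rewrite coordK //; exact: sA].
  by rewrite coordK // => Ap; exists p.
rewrite openE => _ [[p dp <-] /= Ap]; rewrite /interior; apply: filterI.
  by apply: open_nbhs_nbhs; split; [exact: cimg_open|exists p].
have /param_cts : (coord phi @` cdom phi) (coord phi p) by exists p.
by apply; apply: open_nbhs_nbhs; split.
Qed.

Lemma coordI_open (phi psi : chart S n) :
  open (coord phi @` (cdom phi `&` cdom psi)).
Proof.
by apply: coord_open => [|p []//]; apply: openI; exact: cdom_open.
Qed.

Section ChangeOfChart.
Variables (p : S) (phi psi chi : chart_at p).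

Lemma change_differentiable :
  differentiable (coord (sval psi) \o param (sval phi)) (coord (sval phi) p).
Proof.
case: phi psi => [f [af df]] [g [ag dg]] /=.
by have [+ _] := atlas_smooth af ag 1; apply; exists p.
Qed.

Lemma change_id u :
  'd (coord (sval phi) \o param (sval phi)) (coord (sval phi) p) u = u.
Proof.
have N : \forall x \near coord (sval phi) p,
    x = (coord (sval phi) \o param (sval phi)) x.
  case: phi => f [af df] /=.
  have := open_nbhs_nbhs (conj (@cimg_open _ _ f) (ex_intro2 _ _ p df erefl)).
  by apply: filterS => _ [q dq <-] /=; rewrite coordK.
have dI := is_diff_id (coord (sval phi) p).
have [_ ->] := near_eq_diff N (ex_diff (is_diff_def := dI)).
by rewrite diff_val.
Qed.
End ChangeOfChart.

Lemma change_comp (p : S) (phi psi chi : chart_at p) u :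
  'd (coord (sval chi) \o param (sval psi)) (coord (sval psi) p)
    ('d (coord (sval psi) \o param (sval phi)) (coord (sval phi) p) u) =
  'd (coord (sval chi) \o param (sval phi)) (coord (sval phi) p) u.
Proof.
apply: near_diff_comp (change_differentiable phi psi)
  (change_differentiable psi chi).
  by rewrite /= coordK //; case: (svalP phi).
case: phi psi => [f [af df]] [g [ag dg]] /=.
have := open_nbhs_nbhs (conj (@coordI_open f g)
  (ex_intro2 _ _ p (conj df dg) erefl)).
by apply: filterS => _ [q [fq gq] <-] /=; rewrite !coordK.
Qed.

Definition tangent_vec_at (p : S) (phi : chart_at p) (u : 'rV[R]_n) :
    chart_at p -> 'rV[R]_n :=
  fun psi => 'd (coord (sval psi) \o param (sval phi)) (coord (sval phi) p) u.

Lemma tangent_vec_atP p (phi : chart_at p) u :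
  tangent_vec_at phi u \in tangent_pred p.
Proof.
apply/asboolP => psi chi; exact: esym (change_comp phi psi chi u).
Qed.

(* The tangent vector at [p] with coordinates [u] in the chart [phi]. *)
Definition tangent_vec (phi : chart S n) (p : S) (u : 'rV[R]_n) : tangent p :=
  match pselect (atlas phi /\ cdom phi p) with
  | left H => Tangent (tangent_vec_atP (exist _ phi H) u)
  | right _ => 0
  end.

Definition tangent_coords (phi : chart S n) (p : S) (v : tangent p) :
    'rV[R]_n :=
  match pselect (atlas phi /\ cdom phi p) with
  | left H => v (exist _ phi H)
  | right _ => 0
  end.

Section TangentTrivialization.
Variables (phi : chart S n) (aphi : atlas phi).

Lemma tangent_coords_linear p : cdom phi p -> linear (@tangent_coords phi p).
Proof.
move=> dp a v w; rewrite /tangent_coords.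
by case: pselect => [H|[]].
Qed.

Lemma tangent_coordsK p : cdom phi p ->
  cancel (@tangent_coords phi p) (@tangent_vec phi p).
Proof.
move=> dp v; rewrite /tangent_coords /tangent_vec.
case: pselect => [H|[]] //; apply: val_inj; apply/funext => psi /=.
by rewrite /tangent_vec_at /=; have /asboolP/(_ (exist _ phi H) psi) := tangentP v.
Qed.

Lemma tangent_vecK p : cdom phi p ->
  cancel (@tangent_vec phi p) (@tangent_coords phi p).
Proof.
move=> dp u; rewrite /tangent_coords /tangent_vec.
by case: pselect => [H|[]] //=; exact: (change_id (exist _ phi H)).
Qed.

Definition tangent_triv : trivialization n (@tangent : S -> lmodType R) :=
  Trivialization (@cdom_open _ _ phi) tangent_coords_linear
    tangent_coordsK tangent_vecK.
End TangentTrivialization.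

Definition tangent_trivs : set (trivialization n (@tangent : S -> lmodType R)) :=
  [set t | exists phi (aphi : atlas phi), t = tangent_triv aphi].

Lemma tangent_trivs_cover p : exists2 t, tangent_trivs t & tdom t p.
Proof.
have [phi aphi dp] := atlas_cover p.
by exists (tangent_triv aphi) => //; exists phi, aphi.
Qed.

Lemma tangent_trivs_smooth s t : tangent_trivs s -> tangent_trivs t ->
  forall u : 'rV[R]_n,
    smooth_map_on (tdom s `&` tdom t) (fun p => triv t (trivV s p u)).
Proof.
move=> [phi [aphi ->]] [psi [apsi ->]] u chi achi k /=.
set A := (X in Ck _ X _).
have oA : open A.
  apply: coord_open => [|p []//].
  by do 2?apply: openI; exact: cdom_open.
apply: (@Ck_ext _ _ _ _ _
  ((fun x => 'd (coord psi \o param phi) x u) \o (coord phi \o param chi))) => //.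
  move=> _ [p [[fp gp] hp] <-] /=; rewrite coordK //.
  rewrite /tangent_coords /tangent_vec.
  by do 2?[case: pselect => [?|[]//]].
apply: (@Ck_comp _ _ _ _ _ _ (coord phi @` (cdom phi `&` cdom psi))) => //.
- by move=> _ [_ [p [[fp gp] hp] <-] <-] /=; rewrite coordK //; exists p.
- apply: Ck_sub (atlas_smooth achi aphi k).
  by move=> _ [p [[fp gp] hp] <-]; exists p.
by have [_] := atlas_smooth aphi apsi k.+1; exact.
Qed.

Definition tangent_bundle : vbundle S n :=
  VBundle tangent_trivs_cover tangent_trivs_smooth.

End Tangent.

(* g_R = R^* h, where [rsp] is the response bundle morphism R *)
Definition response_metric n (S : manifold n) r (Z : vbundle S r)
    (h : fibre_metric Z) (rsp : bundle_morphism (tangent_bundle S) Z) (p : S)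
    (X Y : tangent_bundle S p) : R :=
  h p (rsp p X) (rsp p Y).

Definition smooth_covariant_2tensor n (S : manifold n)
    (g : forall p, tangent_bundle S p -> tangent_bundle S p -> R) : Prop :=
  (forall p, bilinear_form (g p)) /\ smooth_form g.

End Manifolds.

Arguments manifold : clear implicits.

(* Main.v *)
(** Smoothness is the only point with content.  It is local, so near a given
    point one may fix a trivialization of the target bundle.  Evaluating the
    bundle morphism along the slice x |-> (x, u) of the total space shows that
    the components of the image of a frame vector are smooth, and the pulled-back
    form is a finite sum of products of these components with the components of
    the original form.  The kernel statement is h(R X, R X) = 0 => R X = 0. *)
Require Import Defs.
From HB Require Import structures.
From mathcomp Require Import all_boot all_order all_algebra.
From mathcomp Require Import boolp classical_sets functions reals.
From mathcomp Require Import topology normedtype derive.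

Set Implicit Arguments.
Unset Strict Implicit.
Unset Printing Implicit Defensive.
Import Order.TTheory GRing.Theory Num.Theory.
Import numFieldNormedType.Exports.
Local Open Scope classical_set_scope.
Local Open Scope ring_scope.

Section SmoothFunctions.
Context {R : realType}.

(* [B] need not be open: [Ck] only tests, at the points of the set, a function
   and derivatives that are defined on the whole space. *)
Lemma Ck_local (V W : normedModType R) k (A : set V) (f : V -> W) :
  (forall x, A x -> exists2 B : set V, B x & Ck k B f) -> Ck k A f.
Proof.
elim: k f => [|k IH] f loc /=.
  by move=> x /loc[B Bx]; exact.
split=> [x /loc[B Bx [df _]]|v]; first exact: df.
by apply: IH => x /loc[B Bx [_ cf]]; exists B; [exact: Bx|exact: cf].
Qed.

Lemma Ck_id (V : normedModType R) k (A : set V) : Ck k A (fun x : V => x).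
Proof.
case: k => [|k] /=; first by move=> x _; exact: cvg_id.
split=> [x _|v]; first by have dI := is_diff_id x; exact: ex_diff.
rewrite (_ : (fun x => _) = fun _ => v); first exact: Ck_cst.
by apply/funext => x; have dI := is_diff_id x; rewrite diff_val.
Qed.

Lemma Ck_coord (V : normedModType R) m k (A : set V) (f : V -> 'rV[R]_m)
    (j : 'I_m) :
  open A -> Ck k A f -> Ck k A (fun x => f x 0 j).
Proof.
move=> oA cf.
have @l : {linear 'rV[R]_m -> R}.
  by exists (fun u : 'rV[R]_m => u 0 j); do 2![eexists]; do ?[constructor];
     rewrite ?mxE// => ? *; rewrite ?mxE//; move=> ?; rewrite !mxE.
by apply: (@Ck_lin _ _ _ _ _ _ _ l) => //; exact: coord_continuous.
Qed.

(** The map is affine: coordinates of [x] times constant rows, plus a constant row. It is the slice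
    of a bundle chart at a fixed fibre coordinate [u]. *)
Lemma Ck_row_mxl m p k (A : set 'rV[R]_m) (u : 'rV[R]_p) :
  open A -> Ck k A (fun x => row_mx x u).
Proof.
move=> oA; pose e j : 'rV[R]_(m + p) := row_mx (delta_mx 0 j) 0.
pose f := (fun x : 'rV[R]_m => \sum_(j < m) x 0 j *: e j) \+ cst (row_mx 0 u).
apply: (@Ck_ext _ _ _ k A f) => //.
  move=> x _ /=; rewrite [in RHS](row_sum_delta x).
  apply/rowP => i; rewrite !mxE summxE.
  (* The left block receives only the coordinates of [x]; in the right block every summand vanishes
     and [u] remains. *)
  case: (splitP i) => j ij; rewrite ?mxE ?summxE ?addr0.
    by apply: eq_bigr => l _; rewrite !mxE; case: splitP => j' ij';
       rewrite ?mxE; [have -> : j' = j by apply: val_inj; rewrite /= -ij -ij'|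
         have := ltn_ord j; rewrite -ij ij' ltnNge leq_addr].
  rewrite big1 ?add0r // => l _; rewrite !mxE; case: splitP => j' ij'.
    by have := ltn_ord j'; rewrite -ij' ij ltnNge leq_addr.
  by rewrite mxE mulr0.
apply: CkD => //; last exact: Ck_cst.
apply: Ck_sum => // j; apply: Ck_scale => //; last exact: Ck_cst.
by apply: Ck_coord => //; exact: Ck_id.
Qed.

End SmoothFunctions.

Section Pullback.
Context {R : realType} (n : nat) (S : manifold R n).

(** [triv t] is linear and injective on the fibre, so both sides may be compared in coordinates. *)
Lemma trivV_sum_delta r (E : S -> lmodType R) (t : trivialization r E) p
    (w : E p) :
  tdom t p -> w = \sum_(i < r) triv t w 0 i *: trivV t p (delta_mx 0 i).
Proof.
move=> tp; have tl := triv_linear tp.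
pose T : {linear E p -> 'rV[R]_r} :=
  HB.pack (@triv _ _ _ _ _ t p) (GRing.isLinear.Build _ _ _ _ _ tl).
apply: (can_inj (trivK tp)); rewrite -[triv t _]/(T _) -[RHS]/(T _) linear_sum.
rewrite [LHS](row_sum_delta (T w)); apply: eq_bigr => i _.
by rewrite linearZ /= trivVK.
Qed.

(** The coefficients stay nested as two scalings, the shape that [Ck_scale] handles one factor at a
    time. *)
Lemma bilinear_form_sum (V : lmodType R) (b : V -> V -> R) I J
    (s : seq I) (s' : seq J) (a : I -> R) (x : I -> V) (c : J -> R)
    (y : J -> V) :
  bilinear_form b ->
  b (\sum_(i <- s) a i *: x i) (\sum_(j <- s') c j *: y j) =
  \sum_(i <- s) \sum_(j <- s') a i *: (c j *: b (x i) (y j)).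
Proof.
move=> [bl br].
pose L w : {scalar V} := HB.pack (b w) (GRing.isLinear.Build _ _ _ _ _ (bl w)).
pose M w : {scalar V} :=
  HB.pack (b^~ w) (GRing.isLinear.Build _ _ _ _ _ (br w)).
rewrite -[LHS]/(M _ _) linear_sum; apply: eq_bigr => i _.
rewrite linearZ /= -[b _ _]/(L _ _) linear_sum mulr_sumr.
by apply: eq_bigr => j _; rewrite linearZ.
Qed.

Lemma bundle_morphism_smooth_frame r r' (E : vbundle S r) (E' : vbundle S r')
    (F : bundle_morphism E E') (phi : chart S n) (t : trivialization r E)
    (s : trivialization r' E') (u : 'rV[R]_r) i :
  atlas phi -> trivs t -> trivs s ->
  smooth_on (Defs.coord phi @` (cdom phi `&` tdom t `&` tdom s))
    (fun x => triv s (F _ (trivV t (param phi x) u)) 0 i).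
Proof.
move=> aphi tt ss k; set A := Defs.coord phi @` _.
have oA : open A.
  apply: coord_open => [|q [[]]//].
  by do 2?apply: openI; [exact: cdom_open|exact: tdom_open|exact: tdom_open].
have cF := bmap_smooth F aphi tt aphi ss k.
have cG := Ck_comp oA _ (Ck_row_mxl k u oA) cF.
(* Total space coordinates list the [n] base coordinates first, so [rshift n i] selects the [i]-th
   fibre coordinate. *)
apply: (@Ck_ext _ _ _ _ _ _ _ oA _ (Ck_coord (rshift n i) oA (cG _))).
  by move=> x _; rewrite /= /tot_param row_mxKl row_mxKr /tot_coord row_mxEr.
(* The slice stays in the chart domain: its point over [p] represents the vector [trivV t p u]. *)
move=> _ [_ [p [[pp tp] sp] <-] <-].
exists (existT (fun q => E q) p (trivV t p u)) => //.
by rewrite /tot_coord /= trivVK.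
Qed.

Lemma smooth_form_pullback r r' (E : vbundle S r) (E' : vbundle S r')
    (F : bundle_morphism E E') (b : forall p, E' p -> E' p -> R) :
  (forall p, bilinear_form (@b p)) -> smooth_form b ->
  smooth_form (fun p (x y : E p) => b p (F p x) (F p y)).
Proof.
move=> bb bs t tt u v phi aphi k; apply: Ck_local => _ [p [tp pp] <-].
have [s ss sp] := trivs_cover E' p.
set A := cdom phi `&` tdom t `&` tdom s.
exists (Defs.coord phi @` A); first by exists p.
have oA : open (Defs.coord phi @` A).
  apply: coord_open => [|q [[]]//].
  by do 2?apply: openI; [exact: cdom_open|exact: tdom_open|exact: tdom_open].
pose a w x i := triv s (F _ (trivV t (param phi x) w)) 0 i.
(* Both image vectors are expanded in the frame of [s], which is defined on all of [A]. *)
apply: (@Ck_ext _ _ _ _ _ (fun x => \sum_(i < r') \sum_(j < r')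
    a u x i *: (a v x j *: b (param phi x)
      (trivV s _ (delta_mx 0 i)) (trivV s _ (delta_mx 0 j))))) => //.
  move=> _ [q [[qp qt] qs] <-] /=; rewrite -bilinear_form_sum //.
  by rewrite /a -!trivV_sum_delta // coordK.
have ca w i : Ck k (Defs.coord phi @` A) (a w ^~ i).
  exact: bundle_morphism_smooth_frame.
apply: Ck_sum => // i; apply: Ck_sum => // j.
apply: Ck_scale; [by []|exact: ca|].
apply: Ck_scale; [by []|exact: ca|].
apply: Ck_sub (bs s ss (delta_mx 0 i) (delta_mx 0 j) phi aphi k).
by move=> _ [q [[qp qt] qs] <-]; exists q.
Qed.

End Pullback.

Theorem proposition3p2 (R : realType) (n : nat) (S : manifold R n) (r : nat)
    (Z : vbundle S r) (h : fibre_metric Z)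
    (rsp : bundle_morphism (tangent_bundle S) Z) :
  [/\ smooth_covariant_2tensor (response_metric h rsp),
      forall (p : S) (X Y : tangent_bundle S p),
        response_metric h rsp X Y = response_metric h rsp Y X,
      forall (p : S) (X : tangent_bundle S p), 0 <= response_metric h rsp X X
    & forall p : S,
        [set X : tangent_bundle S p |
          forall Y : tangent_bundle S p, response_metric h rsp X Y = 0] =
        [set X : tangent_bundle S p | rsp p X = 0]].
Proof.
have hl p := (fmet_bilinear h p).
have h0 p (w : Z p) : h p w 0 = 0.
  have [bl _] := hl p.
  (* Linearity at these arguments reads [h w 0 = - h w 0 + h w 0], whose right side is zero. *)
  have := bl w (-1) 0 0; rewrite scaler0 addr0 /= => ->.
  by rewrite mulN1r addNr.
split.
- split=> [p|].
    have [bl br] := hl p; rewrite /response_metric; split=> [X|Y] a v w /=.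
      by rewrite linearP bl.
    by rewrite linearP br.
  exact: (smooth_form_pullback rsp (fmet_bilinear h) (fmet_smooth h)).
- by move=> p X Y; exact: fmet_sym.
- move=> p X; rewrite /response_metric.
  have [->|X0] := eqVneq (rsp p X) 0; first by rewrite h0.
  exact/ltW/fmet_posdef.
move=> p; apply/seteqP; split=> X /= HX.
  (* Testing against [Y = X] contradicts definiteness of [h] at [rsp p X]. *)
  apply/eqP/negP => /negP X0; have := fmet_posdef h X0.
  by rewrite -/(response_metric h rsp X X) HX ltxx.
by move=> Y; rewrite /response_metric HX fmet_sym h0.
Qed.
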